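(* For every integer $\ell \geq 0$, there are infinitely many graphs with terminals $(G,T)$ such that (1) $T$ is $(3\cdot 2^\ell)$-edge-connected in $G$, and (2) $G$ does not contain $2^\ell$ pairwise edge-disjoint $T$-connectors.
   Context: Graphs are finite and may have parallel edges. A graph with terminals is a pair $(G,T)$ where $G$ is a graph and $T\subseteq V(G)$; vertices of $T$ are terminals, the others are non-terminals. For a positive integer $d$, the set $T$ is $d$-edge-connected in $G$ if $G$ has no edge-cut of size smaller than $d$ separating two vertices of $T$ (equivalently, any two vertices of $T$ are joined by $d$ edge-disjoint paths in $G$); no assumption is made on the connectivity of $G$ itself. A $T$-path in $G$ is a path whose two endvertices belong to $T$ and which is otherwise disjoint from $T$. Short-cutting a nontrivial path $P$ means removing all edges of $P$ and adding an edge joining its two endvertices. A $T$-connector in $G$ is the union of a family of pairwise edge-disjoint $T$-paths in $G$ such that, after short-cutting these $T$-paths one by one, the resulting graph has a connected induced subgraph on $T$. *)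

(* Defs.v *)
From HB Require Import structures.
From mathcomp Require Import all_boot.

Set Implicit Arguments.
Unset Strict Implicit.
Unset Printing Implicit Defensive.

(* Finite loopless multigraphs: parallel edges are distinct elements of [edge]
   with the same set of ends. *)
Record mgraph : Type := MGraph {
  vert : finType;
  edge : finType;
  ends : edge -> {set vert};
  card_ends : forall e, #|ends e| = 2
}.
Arguments ends {m} e.

Record tgraph : Type := TGraph {
  graph_of :> mgraph;
  terms : {set vert graph_of}
}.

Definition tgraph_iso (G H : tgraph) : Prop :=
  exists (f : vert G -> vert H) (g : edge G -> edge H),
    [/\ bijective f, bijective g,
        forall e, ends (g e) = f @: ends e
      & f @: terms G = terms H].

Section MultiGraph.

Variable G : mgraph.
Implicit Types (T X : {set vert G}) (d : nat).

Definition cut X : {set edge G} :=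
  [set e | (ends e :&: X != set0) && (ends e :\: X != set0)].

Definition edge_connected_in d T : Prop :=
  forall X x y, x \in T -> y \in T -> x \in X -> y \notin X -> d <= #|cut X|.

(* [(x, [:: (e1, x1); ...; (en, xn)])] stands for the alternating sequence
   x e1 x1 ... en xn. *)
Definition gwalk : Type := (vert G * seq (edge G * vert G))%type.
Implicit Types p : gwalk.

Fixpoint walk_from (x : vert G) (s : seq (edge G * vert G)) : bool :=
  if s is (e, y) :: s' then (ends e == [set x; y]) && walk_from y s' else true.

Definition source p : vert G := p.1.
Definition walk_vseq p : seq (vert G) := p.1 :: [seq u.2 | u <- p.2].
Definition target p : vert G := last p.1 [seq u.2 | u <- p.2].
Definition walk_verts p : {set vert G} := [set x in walk_vseq p].
Definition walk_edges p : {set edge G} := [set e in [seq u.1 | u <- p.2]].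

Definition is_path p : bool := walk_from p.1 p.2 && uniq (walk_vseq p).

Definition is_Tpath T p : Prop :=
  [/\ is_path p, source p != target p, source p \in T, target p \in T
    & forall x, x \in walk_vseq p -> x \in T -> x = source p \/ x = target p].

Definition subgraph : Type := ({set vert G} * {set edge G})%type.

Definition walks_union (ps : seq gwalk) : subgraph :=
  (\bigcup_(p <- ps) walk_verts p, \bigcup_(p <- ps) walk_edges p).

Definition edge_disjoint (A B : subgraph) : bool := [disjoint A.2 & B.2].

(* A graph on the vertex set of [G] obtained from a subgraph by short-cuttings:
   the edges of [G] that are still present, and the new edges (a multiset, each given by its set
   of ends). *)
Record scgraph : Type := SCGraph {
  kept : {set edge G};
  added : seq {set vert G}
}.

Definition uncut (C : subgraph) : scgraph := SCGraph C.2 [::].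

Definition shortcut (H : scgraph) p : scgraph :=
  SCGraph (kept H :\: walk_edges p) ([set source p; target p] :: added H).

Definition adjacent (H : scgraph) : rel (vert G) := fun x y =>
  [exists e in kept H, ends e == [set x; y]] || ([set x; y] \in added H).

(* The empty graph counts as connected, so that no graph lacks connectors merely
   because it has no terminals. *)
Definition induced_connected (H : scgraph) T : Prop :=
  forall x y, x \in T -> y \in T ->
    connect [rel u v | [&& u \in T, v \in T & adjacent H u v]] x y.

(* The paths are short-cut in their union [C], so edges of [G] outside the
   connector do not help to connect [T]. *)
Definition is_Tconnector T (C : subgraph) : Prop :=
  exists ps : seq gwalk,
    [/\ forall p, p \in ps -> is_Tpath T p,
        pairwise (fun p q => [disjoint walk_edges p & walk_edges q]) ps,
        C = walks_union ps
      & induced_connected (foldl shortcut (uncut C) ps) T].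

(* Indexed family: edgeless connectors (possible when #|T| <= 1) may be repeated. *)
Definition has_disjoint_Tconnectors (k : nat) T : Prop :=
  exists C : 'I_k -> subgraph,
    (forall i, is_Tconnector T (C i)) /\
    (forall i j, i != j -> edge_disjoint (C i) (C j)).

End MultiGraph.

(* Main.v *)
Require Import Defs.
From mathcomp Require Import all_boot zify.

Set Implicit Arguments.
Unset Strict Implicit.
Unset Printing Implicit Defensive.

(* Write k = d + 1 = 2 ^ l.  Each vertex v of a cubic multigraph L is replaced by a gadget
   with three terminals, three ports (each adjacent to two of the terminals and attached to one
   edge of L), and 2k - 1 claws on the terminals.  Further k - 1 claws per vertex join the gadgets
   according to a 3-regular 3-uniform hypergraph on V(L).  A claw or a port carries at most
   one path of a family of edge-disjoint T-paths.  Let x(v) be the number of ports of v whose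
   edge of L is used.  Since k connectors need k(|V(L)| - 1) paths between gadgets, and one
   more for every gadget that some connector does not connect internally, a count shows that
   x(v) = 2 for all but at most 2k vertices v: the used edges almost form a 2-factor of L.

   If k > 1, only L together with the hypergraph has to be 3k-edge-connected, so L can consist
   of 3k copies of a cubic multigraph without 2-factor.  If k = 1, then L must be
   3-edge-connected and the used edges must also connect it; L consists of four copies of the
   Petersen graph minus a vertex, joined as a K4.  Every 2-factor of such a copy contains a
   whole cycle, because the Petersen graph has no Hamiltonian cycle.  Isolated
   non-terminals make the examples pairwise non-isomorphic. *)

(** * Counting the paths of a connector *)

(** One index type for the terminals and ports of a gadget, the ends of a claw and the edges at a
    cubic vertex. *)
Definition tri : finType := option bool.

Lemma sum_tri (F : tri -> nat) :
  \sum_i F i = F None + F (Some false) + F (Some true).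
Proof.
rewrite (bigD1 None) //= (bigD1 (Some false)) //= (bigD1 (Some true)) //=.
by rewrite big1 ?addn0 ?addnA // => -[[]|].
Qed.

Lemma tri_third (i j : tri) : exists q, (q != i) && (q != j).
Proof.
by move: i j => [[]|] [[]|]; (exists None + exists (Some true) + exists (Some false)).
Qed.

(** Choosing a partner for every [i] gives an injection. As [w] is a proposition, the choice is
    built along [enum I]; values in [option J] also cover an empty [J]. *)
Lemma leq_card_rel (I J : finType) (A : {pred I}) (B : {pred J})
    (w : I -> J -> Prop) :
    (forall i, i \in A -> exists2 j, j \in B & w i j) ->
    (forall i i' j, i \in A -> i' \in A -> w i j -> w i' j -> i = i') ->
  #|A| <= #|B|.
Proof.
move=> exw injw.
have [f fP] : exists f : {ffun I -> option J}, forall i, i \in A ->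
    exists j, [/\ f i = Some j, j \in B & w i j].
  have : forall s : seq I, exists f : {ffun I -> option J}, forall i, i \in A ->
      i \in s -> exists j, [/\ f i = Some j, j \in B & w i j].
    elim=> [|i s [f IH]]; first by exists [ffun=> None].
    have [iA|iNA] := boolP (i \in A); last first.
      exists f => i' i'A; rewrite inE => /orP[/eqP e|]; last exact: IH.
      by rewrite e (negbTE iNA) in i'A.
    have [j jB wij] := exw i iA.
    exists [ffun i' => if i' == i then Some j else f i'] => i' i'A.
    rewrite inE ffunE; case: eqP => [-> _|_ /= i's]; first by exists j.
    exact: IH.
  by case/(_ (enum I)) => f fP; exists f => i iA; apply: fP => //; rewrite mem_enum.
have finj : {in A &, injective f}.
  move=> i i' iA i'A eqf; have [j [fi _ wi]] := fP i iA.
  have [j' [fi' _ wi']] := fP i' i'A.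
  by move: eqf; rewrite fi fi' => -[ejj]; apply: injw wi _ => //; rewrite ejj.
rewrite -(card_in_imset finj) -(card_imset [in B] Some_inj).
apply: subset_leq_card; apply/subsetP => _ /imsetP[i iA ->].
by have [j [-> jB _]] := fP i iA; apply: imset_f.
Qed.

Section Connectors.

Variable G : mgraph.
Implicit Types (T : {set vert G}) (ps : seq (gwalk G)).

(** Applied to the union of the paths [ps]: then nothing is kept, and every remaining edge joins the
    ends of one path. *)
Lemma foldl_shortcutE ps (H : scgraph G) :
  kept (foldl (@shortcut G) H ps) =
    kept H :\: \bigcup_(p <- ps) walk_edges p /\
  (forall A, A \in added (foldl (@shortcut G) H ps) ->
     A \in added H \/ exists2 p, p \in ps & A = [set source p; target p]).
Proof.
elim: ps H => [|p ps IH] H /=; first by rewrite big_nil setD0; split=> // A; left.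
have [-> addedP] := IH (shortcut H p); rewrite big_cons setDDl; split=> // A.
case/addedP => /= [|[q qps ->]]; last by right; exists q => //; rewrite inE qps orbT.
rewrite inE => /orP[/eqP->|]; last by left.
by right; exists p => //; rewrite inE eqxx.
Qed.

Lemma set2_eq (U : finType) (a b x y : U) :
  [set a; b] = [set x; y] -> (a = x /\ b = y) \/ (a = y /\ b = x).
Proof.
move=> eqab.
have /set2P[ax|ay] : a \in [set x; y] by rewrite -eqab set21.
  have /set2P[bx|->] : b \in [set x; y] by rewrite -eqab set22.
    have : y \in [set a; b] by rewrite eqab set22.
    by rewrite ax bx setUid inE => /eqP->; left.
  by left.
have /set2P[->|bY] : b \in [set x; y] by rewrite -eqab set22.
  by right.
have : x \in [set a; b] by rewrite eqab set21.
by rewrite ay bY setUid inE => /eqP->; left.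
Qed.

Lemma connector_constant T (U : Type) (f : vert G -> U) ps :
    induced_connected (foldl (@shortcut G) (uncut (walks_union ps)) ps) T ->
    (forall p, p \in ps -> f (source p) = f (target p)) ->
  {in T &, forall x y, f x = f y}.
Proof.
move=> conn fps x y xT yT; have /connectP[s] := conn _ _ xT yT.
have [keptE addedP] := foldl_shortcutE ps (uncut (walks_union ps)).
elim: s x {xT} => [|z s IH] x /=; first by move=> _ ->.
case/andP => /and3P[_ _ xz] zs ys; rewrite -(IH z zs ys).
move: xz; rewrite /adjacent keptE /= setDv.
case/orP => [/exists_inP[e]|/addedP[//|[p pps eqp]]]; first by rewrite inE.
have fp := fps _ pps.
by case: (set2_eq eqp) => -[-> ->].
Qed.

(* Contract the edges of the connected graph one at a time: only those that
   are not yet loops lower the number of vertices. *)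
Lemma contracted_connected_edges (S : finType) (A : {set S}) (U : finType)
    (E : Type) (src tgt : E -> S) (s : seq E) (f : S -> U) :
    (forall g : U -> U, all (fun e => g (f (src e)) == g (f (tgt e))) s ->
       {in A &, forall x y, g (f x) = g (f y)}) ->
  #|f @: A| <= (count (fun e => f (src e) != f (tgt e)) s).+1.
Proof.
elim: s f => [|e s IH] f conn.
  have [->|[x xA]] := set_0Vmem A; first by rewrite imset0 cards0.
  rewrite -(cards1 (f x)); apply: subset_leq_card; apply/subsetP.
  by move=> _ /imsetP[y yA ->]; rewrite inE; apply/eqP; apply: (conn id).
rewrite [count _ _]/=; have [fe|neq] := eqVneq (f (src e)) (f (tgt e)); rewrite /= ?add0n ?add1n.
  apply: IH => g gs; apply: conn => /=.
  by rewrite gs fe eqxx.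
pose h u := if u == f (tgt e) then f (src e) else u.
have hs : h (f (src e)) = f (src e) by rewrite /h (negbTE neq).
have ht : h (f (tgt e)) = f (src e) by rewrite /h eqxx.
have {}IH : #|(h \o f) @: A| <=
    (count (fun e' => (h \o f) (src e') != (h \o f) (tgt e')) s).+1.
  apply: IH => g gs; apply: (conn (g \o h)) => /=.
  by rewrite hs ht eqxx.
have sub : f @: A \subset f (tgt e) |: (h \o f) @: A.
  apply/subsetP => _ /imsetP[x xA ->]; rewrite !inE.
  have [//|neqx] /= := eqVneq; apply/imsetP; exists x => //=.
  by rewrite /h (negbTE neqx).
have := leq_trans (subset_leq_card sub) (leq_card_setU _ _).
rewrite cards1 => le1.
have le2 : count (fun e' => (h \o f) (src e') != (h \o f) (tgt e')) s <=
   count (fun e' => f (src e') != f (tgt e')) s.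
  by apply: sub_count => e' /=; apply: contra_neq => ->.
lia.
Qed.

(** Merging the fibres of [f] leaves a connected graph on [f @: T], which needs at least [#|f @: T|]
    minus one edges that are not loops. *)
Lemma connector_contracted_edges T (U : finType) (f : vert G -> U) ps :
    induced_connected (foldl (@shortcut G) (uncut (walks_union ps)) ps) T ->
  #|f @: T| <= (count (fun p => f (source p) != f (target p)) ps).+1.
Proof.
move=> conn; apply: contracted_connected_edges => g /allP gps.
by apply: (connector_constant (f := g \o f) conn) => p /gps /eqP.
Qed.

(** If the path entered and left [w] by the same edge, it would repeat the vertex before [w]. *)
Lemma path_inner_edges (p : gwalk G) w :
    is_path p -> w \in walk_vseq p -> w != source p -> w != target p ->
  exists e e', [/\ e != e', e \in walk_edges p, e' \in walk_edges p,
    w \in ends e & w \in ends e'].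
Proof.
case: p => s l; rewrite /is_path /walk_edges /target /source /=.
elim: l s => [|[e x] l IH] s /=.
  by rewrite /walk_vseq /= inE => _ /eqP-> /eqP.
case/andP => /andP[/eqP eE pl] /= /andP[sNl ul].
rewrite inE => /orP[/eqP->|]; first by rewrite eqxx.
move=> wl ws wt; have [wx|wx] := eqVneq w x; last first.
  have [|e1 [e2 [ne e1l e2l we1 we2]]] := IH x _ wl wx wt.
    by rewrite pl.
  by exists e1, e2; split=> //; rewrite !inE in e1l e2l *; rewrite ?e1l ?e2l orbT.
rewrite {}wx in ws wt wl *; case: l pl sNl ul wt {wl IH} => [|[e' y] l] /=.
  by rewrite eqxx.
case/andP => /eqP e'E _ sNl _ _; exists e, e'; split.
- apply: contraNneq sNl => ee'; move: eE; rewrite ee' e'E.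
  by case/set2_eq => [[xs _]|[_ ys]]; rewrite !inE ?xs ?ys eqxx ?orbT.
- by rewrite !inE eqxx.
- by rewrite !inE eqxx orbT.
- by rewrite eE set22.
- by rewrite e'E set21.
Qed.

End Connectors.

Lemma pairwise_count_le1 (S : eqType) (r : rel S) (a : pred S) (s : seq S) :
    pairwise r s -> {in s &, forall p q, a p -> a q -> ~~ r p q} ->
  count a s <= 1.
Proof.
elim: s => [//|p s IH] /= /andP[/allP rp pw] ar.
have {IH} IH : count a s <= 1.
  by apply: IH => // q q' qs q's; apply: ar; rewrite inE ?qs ?q's orbT.
case ap : (a p); last by rewrite add0n.
rewrite (@eq_in_count _ _ pred0) ?count_pred0 // => q qs /=.
apply/negP => aq; have := ar p q; rewrite !inE eqxx qs orbT => /(_ isT isT ap aq).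
by rewrite rp.
Qed.

Lemma sub_in_count (S : eqType) (a b : pred S) (s : seq S) :
  {in s, subpred a b} -> count a s <= count b s.
Proof.
move=> ab; rewrite (@eq_in_count _ a (predI a b)); last first.
  by move=> p ps /=; case ap : (a p); rewrite //= ab.
by apply: sub_count => p /andP[].
Qed.

Lemma card_set_sum (S : finType) (P : pred S) : #|[set x | P x]| = \sum_x P x.
Proof. by rewrite -sum1_card big_mkcond; apply: eq_bigr => x _; rewrite inE; case: (P x). Qed.

Lemma sum_pair (A B : finType) (F : A * B -> nat) : \sum_p F p = \sum_a \sum_b F (a, b).
Proof. by rewrite (pair_bigA _ (fun a b => F (a, b))); apply: eq_bigr => -[]. Qed.

(** * The gadget graph *)

Section Construction.

Variables (V : finType) (sigma : V * tri -> V * tri) (tau : tri -> V -> V).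
Variables (d m : nat).

Definition port : finType := (V * tri)%type.
(** First the claws inside each gadget, then [d] parallel claws per hyperedge; a 3-regular 3-uniform
    hypergraph has as many hyperedges as vertices, so [V] indexes both. *)
Definition claw : finType := (V * 'I_d.*2.+1 + V * 'I_d)%type.
Definition gvert : finType := ((V * tri + port) + (claw + 'I_m))%type.

Definition term (t : V * tri) : gvert := inl (inl t).
Definition pvert (z : port) : gvert := inl (inr z).
Definition cvert (y : claw) : gvert := inr (inl y).

(** Leaf [q] of a claw is terminal [q] of this gadget; thus [tau q c] is the member of the hyperedge
    [c] with index [q]. *)
Definition claw_node (y : claw) (q : tri) : V :=
  match y with inl c => c.1 | inr c => tau q c.1 end.

Definition arc (x y : gvert) : bool :=
  match x, y with
  | inl (inr z), inl (inl t) => (t.1 == z.1) && (t.2 != z.2)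
  | inl (inr z), inl (inr z') => z' == sigma z
  | inr (inl c), inl (inl t) => t.1 == claw_node c t.2
  | _, _ => false
  end.

Definition adj : rel gvert := fun x y => arc x y || arc y x.

Definition is_gedge (e : {set gvert}) : bool :=
  [exists x, exists y, adj x y && (e == [set x; y])].

(** The gadget graph is simple even over a multigraph, since parallel edges end at different
    ports. *)
Definition gedge : finType := {e : {set gvert} | is_gedge e}.

Hypothesis sigmaK : involutive sigma.
Hypothesis sigma_node : forall z, (sigma z).1 != z.1.

Lemma adj_irrefl x : ~~ adj x x.
Proof.
case: x => [[t|z]|[y|r]] //=; rewrite /adj /= orbb.
by apply/eqP => zz; have := sigma_node z; rewrite -zz eqxx.
Qed.

Lemma card_gedge (e : gedge) : #|val e| = 2.
Proof.
have /existsP[x /existsP[y /andP[xy /eqP->]]] := valP e.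
by rewrite cards2; case: eqP xy => // ->; rewrite (negbTE (adj_irrefl y)).
Qed.

Definition ggraph : mgraph := MGraph card_gedge.

Definition gterms : {set vert ggraph} := [set term t | t : V * tri].

Definition gtgraph : tgraph := TGraph gterms.

Lemma adjC x y : adj x y = adj y x.
Proof. by rewrite /adj orbC. Qed.

Lemma ends_adj (e : edge ggraph) x y : ends e = [set x; y] -> adj x y.
Proof.
have /existsP[x' /existsP[y' /andP[xy /eqP eE]]] := valP e.
by rewrite -[ends e]/(val e) eE => /set2_eq [] [<- <-] //; rewrite adjC.
Qed.

Lemma adj_edge x y : adj x y -> exists e : edge ggraph, ends e = [set x; y].
Proof.
move=> xy; have ge : is_gedge [set x; y].
  by apply/existsP; exists x; apply/existsP; exists y; rewrite xy /=.
by exists (exist (fun e => is_true (is_gedge e)) _ ge).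
Qed.

Lemma ends_inj : injective (@ends ggraph).
Proof. exact: val_inj. Qed.

Lemma term_in t : term t \in gterms.
Proof. exact: imset_f. Qed.

Lemma in_gterms (x : gvert) :
  (x \in gterms) = if x is inl (inl _) then true else false.
Proof.
case: x => [[t|z]|y]; first exact: term_in.
  by apply/imsetP => -[].
by apply/imsetP => -[].
Qed.

(** * The shape of T-paths in the gadget graph *)

Lemma adj_term t x : adj (term t) x ->
  (exists2 y, x = cvert y & t.1 = claw_node y t.2) \/
  (exists z, [/\ x = pvert z, t.1 = z.1 & t.2 != z.2]).
Proof.
rewrite /adj; case: x => [[t'|z]|[y|r]] //=.
  by case/andP => /eqP tz tz2; right; exists z.
by move/eqP => ty; left; exists y.
Qed.

Lemma adj_claw y x : adj (cvert y) x ->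
  exists2 t, x = term t & t.1 = claw_node y t.2.
Proof. by rewrite /adj; case: x => [[t|z]|[y'|r]] //=; rewrite orbF => /eqP yt; exists t. Qed.

Lemma adj_port z x : adj (pvert z) x ->
  (exists t, [/\ x = term t, t.1 = z.1 & t.2 != z.2]) \/ x = pvert (sigma z).
Proof.
rewrite /adj; case: x => [[t|z']|[y|r]] //=.
  by rewrite orbF => /andP[/eqP tz tz2]; left; exists t.
by case/orP => /eqP ->; right; rewrite ?sigmaK.
Qed.

(** The only edges between non-terminals join a port to its mate under [sigma], so a T-path passes
    one claw, one port or two linked ports. *)
Variant Tpath_spec (p : gwalk ggraph) : Prop :=
| ViaClaw y t t' of source p = term t & target p = term t' &
    t.1 = claw_node y t.2 & t'.1 = claw_node y t'.2 &
    walk_vseq p = [:: term t; cvert y; term t']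
| ViaPort z t t' of source p = term t & target p = term t' &
    t.1 = z.1 & t'.1 = z.1 & t.2 != z.2 & t'.2 != z.2 &
    walk_vseq p = [:: term t; pvert z; term t']
| ViaLink z t t' of source p = term t & target p = term t' &
    t.1 = z.1 & t'.1 = (sigma z).1 &
    walk_vseq p = [:: term t; pvert z; pvert (sigma z); term t'].

Lemma TpathP p : is_Tpath gterms p -> Tpath_spec p.
Proof.
case: p => s w [/andP[/= pw up] st sT tT Tst].
have Tst' x : x \in walk_vseq (s, w) -> x \in gterms -> x != s -> x = target (s, w).
  by move=> xw xT xs; case: (Tst x xw xT) => // e; rewrite e eqxx in xs.
case/imsetP: sT => t _ /= sE; rewrite {}sE in pw up st Tst Tst' tT *.
case: w pw up st tT Tst Tst' => [|[e x] w]; first by rewrite eqxx.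
move=> /= /andP[/eqP ex pw] up st tT Tst Tst'.
(* A path cannot continue after reaching its target, because its vertices are distinct. *)
have stop t1 l : walk_from (G:=ggraph) (term t1) l -> uniq (term t1 :: [seq u.2 | u <- l]) ->
    last (term t1) [seq u.2 | u <- l] = term t1 -> l = [::].
  case: l => [//|u l] _ /= /andP[tl _] lt; move: tl.
  by rewrite -{1}lt mem_last.
case: (adj_term (ends_adj ex)) => [[y xE ty]|[z [xE tz tz2]]].
  rewrite {}xE in ex pw up st tT Tst Tst' *.
  case: w pw up st tT Tst Tst' => [|[e' x'] w].
    by move=> _ _ _; rewrite in_gterms.
  move=> /= /andP[/eqP ex' pw] up st tT Tst Tst'.
  have [t' xE ty'] := adj_claw (ends_adj ex').
  rewrite {}xE in ex' pw up st tT Tst Tst' *.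
  have tt' : term t' != term t.
    by move: up => /and3P[+ _ _]; rewrite !inE !negb_or => /and3P[_ + _]; rewrite eq_sym.
  have tgt := Tst' (term t'); rewrite !inE eqxx !orbT term_in in tgt.
  move: (tgt isT isT tt') => {}tgt.
  have wnil : w = [::].
    apply: (stop t') => //; first by case/and3P: up => _ _ /=.
  subst w; apply: (@ViaClaw _ y t t') => //.
rewrite {}xE in ex pw up st tT Tst Tst' *.
case: w pw up st tT Tst Tst' => [|[e' x'] w].
  by move=> _ _ _; rewrite in_gterms.
move=> /= /andP[/eqP ex' pw] up st tT Tst Tst'.
case: (adj_port (ends_adj ex')) => [[t' [xE tz' tz2']]|xE].
  rewrite {}xE in ex' pw up st tT Tst Tst' *.
  have tt' : term t' != term t.
    by move: up => /and3P[+ _ _]; rewrite !inE !negb_or => /and3P[_ + _]; rewrite eq_sym.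
  have tgt := Tst' (term t'); rewrite !inE eqxx !orbT term_in in tgt.
  move: (tgt isT isT tt') => {}tgt.
  have wnil : w = [::].
    by apply: (stop t') => //; case/and3P: up => _ _ /=.
  by subst w; apply: (@ViaPort _ z t t').
rewrite {}xE in ex' pw up st tT Tst Tst' *.
case: w pw up st tT Tst Tst' => [|[e'' x''] w].
  by move=> _ _ _; rewrite in_gterms.
move=> /= /andP[/eqP ex'' pw] up st tT Tst Tst'.
case: (adj_port (ends_adj ex'')) => [[t' [xE tz' tz2']]|xE]; last first.
  by move: up; rewrite xE sigmaK !inE eqxx /= !orbT !andbF.
rewrite {}xE in ex'' pw up st tT Tst Tst' *.
have tt' : term t' != term t.
  by move: up => /and4P[+ _ _ _]; rewrite !inE !negb_or => /and4P[_ _ + _]; rewrite eq_sym.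
have tgt := Tst' (term t'); rewrite !inE eqxx !orbT term_in in tgt.
move: (tgt isT isT tt') => {}tgt.
have wnil : w = [::].
  by apply: (stop t') => //; case/and4P: up => _ _ _ /=.
by subst w; apply: (@ViaLink _ z t t').
Qed.


(** A claw has one neighbour per index; a port has its mate in place of the terminal with its own
    index. *)
Lemma card_incident (w : gvert) :
  w \notin gterms -> #|[set e : edge ggraph | w \in ends e]| <= 3.
Proof.
move=> wNT; have card3 : #|tri| = 3 by rewrite card_option card_bool.
apply: leq_trans (_ : #|[set x | adj w x]| <= _).
  apply: (@leq_card_rel (edge ggraph) gvert _ _ (fun e x => ends e = [set w; x : gvert])).
    move=> e; rewrite inE => we.
    have /existsP[x /existsP[y /andP[xy /eqP eE]]] := valP e.
    have : w \in [set x; y] by rewrite -eE.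
    rewrite !inE => /orP[] /eqP wE; [exists y|exists x]; rewrite ?inE wE //.
      by rewrite adjC.
    by rewrite setUC.
  by move=> e e' x _ _ eE e'E; apply: ends_inj; rewrite eE.
rewrite -card3; case: w wNT => [[t|z]|[y|r]]; first by rewrite term_in.
- move=> _; pose f q := if q == z.2 then pvert (sigma z) else term (z.1, q).
  apply: leq_trans (_ : #|f @: setT| <= _); last first.
    by rewrite -cardsT leq_imset_card.
  apply: subset_leq_card; apply/subsetP => x; rewrite inE => /adj_port.
  case=> [[[v j] /= [-> -> jz]]|->]; apply/imsetP.
    by exists j; [rewrite in_setT|rewrite /f (negbTE jz)].
  by exists z.2; [rewrite in_setT|rewrite /f eqxx].
- move=> _; pose f q := term (claw_node y q, q).
  apply: leq_trans (_ : #|f @: setT| <= _); last first.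
    by rewrite -cardsT leq_imset_card.
  apply: subset_leq_card; apply/subsetP => x; rewrite inE => /adj_claw.
  by case=> -[v j] -> /= ->; apply/imsetP; exists j; rewrite ?in_setT.
- move=> _; rewrite (_ : [set x | _] = set0) ?cards0 //.
  by apply/setP => x; rewrite !inE /adj; case: x => [[]|[]].
Qed.

(** Each path uses two edges at [w], and there are at most three. *)
Lemma Tpaths_share_edge p q (w : gvert) :
    is_Tpath gterms p -> is_Tpath gterms q -> w \notin gterms ->
    w \in walk_vseq p -> w \in walk_vseq q ->
  ~~ [disjoint walk_edges p & walk_edges q].
Proof.
move=> Tp Tq wT wp wq; apply/negP => pq.
have two r : is_Tpath gterms r -> w \in walk_vseq r ->
    1 < #|walk_edges r :&: [set e : edge ggraph | w \in ends e]|.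
  case=> pr _ srcT tgtT _ wr.
  have [||e [e' [ne er e'r we we']]] := path_inner_edges pr wr.
  - by apply: contraNneq wT => ->.
  - by apply: contraNneq wT => ->.
  apply: leq_trans (_ : #|[set e; e']| <= _); first by rewrite cards2 ne.
  apply: subset_leq_card; apply/subsetP => x /set2P[]->; rewrite in_setI.
    by rewrite er /= inE.
  by rewrite e'r /= inE.
have := leq_add (two p Tp wp) (two q Tq wq).
rewrite -cardsUI setIACA (disjoint_setI0 pq) set0I cards0 addn0 -setIUl.
have := subset_leq_card (subsetIr (walk_edges p :|: walk_edges q)
  [set e : edge ggraph | w \in ends e]).
have := card_incident wT; lia.
Qed.

(** * Paths between gadgets and paths inside a gadget *)

Hypothesis tau_neq : forall q q' c, q != q' -> tau q c != tau q' c.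

Definition node (x : gvert) : option V := if x is inl (inl t) then Some t.1 else None.

Definition outer (p : gwalk ggraph) := node (source p) != node (target p).

Definition inner v (p : gwalk ggraph) :=
  (node (source p) == Some v) && (node (target p) == Some v).

(** An outer path passes one outer claw or two linked ports; the weights 2 and 1 balance the two
    cases. *)
Lemma outer_vertices p : is_Tpath gterms p -> outer p ->
  2 <= \sum_(x : V * 'I_d + port)
         (if x is inl _ then 2 else 1) *
         ((match x with inl c => cvert (inr c) | inr z => pvert z end) \in walk_vseq p).
Proof.
move=> Tp; rewrite /outer; case: (TpathP Tp).
- case=> c t t' -> -> /= -> ->; first by rewrite eqxx.
  by move=> -> _; rewrite (bigD1 (inl c)) //= !inE eqxx orbT.
- by move=> z t t' -> -> /= -> ->; rewrite eqxx.
move=> z t t' -> -> /= _ _ -> _; rewrite (bigD1 (inr z)) //= (bigD1 (inr (sigma z))) /=.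
  by rewrite !inE !eqxx !orbT.
rewrite -[inr _ == inr _]/(sigma z == z); apply: contraNneq (sigma_node z) => ->.
by rewrite eqxx.
Qed.

(** An outer claw has its leaves in three different gadgets, so it cannot carry an inner path. *)
Lemma inner_vertices v p : is_Tpath gterms p -> inner v p ->
  1 <= \sum_(x : 'I_d.*2.+1 + tri)
         1 * ((match x with inl r => cvert (inl (v, r)) | inr i => pvert (v, i) end)
               \in walk_vseq p).
Proof.
move=> Tp; have [_ st _ _ _] := Tp; rewrite /inner; case: (TpathP Tp).
- case=> [[c r] t t' -> -> /= -> -> -> |c t t' sp tp].
    by case/andP => /eqP[->] _; rewrite (bigD1 (inl r)) //= !inE eqxx orbT.
  rewrite sp tp /= => tc tc' _ /andP[/eqP[tv] /eqP[tv']].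
  have [qq|] := eqVneq t.2 t'.2; last by move/(tau_neq c.1); rewrite -tc -tc' tv tv' eqxx.
  move: st; rewrite sp tp; case/eqP.
  by rewrite [t]surjective_pairing [t']surjective_pairing qq tv tv'.
- case=> c i t t' -> -> /= -> -> _ _ ->.
  by case/andP => /eqP[->] _; rewrite (bigD1 (inr i)) //= !inE eqxx orbT.
move=> z t t' -> -> /= -> -> _ /andP[/eqP[<-]].
by rewrite -[Some _ == _]/((sigma z).1 == z.1) (negbTE (sigma_node z)).
Qed.

Lemma outer_sigma p z : is_Tpath gterms p -> outer p ->
  (pvert (sigma z) \in walk_vseq p) = (pvert z \in walk_vseq p).
Proof.
move=> Tp; rewrite /outer; case: (TpathP Tp).
- by move=> y t t' _ _ _ _ ->; rewrite !inE.
- by move=> z' t t' -> -> /= -> ->; rewrite eqxx.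
move=> z' t t' _ _ _ _ -> _; rewrite !inE /= !orbF.
rewrite -![pvert _ == _]/(_ == _ :> port) (can_eq sigmaK) orbC.
by congr (_ || _); rewrite -(can_eq sigmaK) sigmaK.
Qed.

(** * Counting the paths of d + 1 disjoint connectors *)

Section Obstruction.

Variable ps : 'I_d.+1 -> seq (gwalk ggraph).
Hypothesis ps_Tpath : forall i p, p \in ps i -> is_Tpath gterms p.
Hypothesis ps_pairwise : forall i,
  pairwise (fun p q => [disjoint walk_edges p & walk_edges q]) (ps i).
Hypothesis ps_disjoint : forall i j p q, i != j -> p \in ps i -> q \in ps j ->
  [disjoint walk_edges p & walk_edges q].
Hypothesis ps_conn : forall i,
  induced_connected (foldl (@shortcut ggraph) (uncut (walks_union (ps i))) (ps i)) gterms.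

Definition total (a : pred (gwalk ggraph)) := \sum_i count a (ps i).

Lemma totalE a : total a = \sum_i \sum_(p <- ps i) a p.
Proof.
apply: eq_bigr => i _; rewrite -sum1_count big_mkcond /=.
by apply: eq_bigr => p _; case: (a p).
Qed.

Lemma total_sum_le (X : finType) (a : pred (gwalk ggraph)) (b : X -> pred (gwalk ggraph))
    (n : nat) (w : X -> nat) :
    (forall i p, p \in ps i -> a p -> n <= \sum_x w x * b x p) ->
  n * total a <= \sum_x w x * total (fun p => a p && b x p).
Proof.
move=> ab; under eq_bigr => x _ do rewrite totalE big_distrr.
rewrite totalE big_distrr exchange_big /=; apply: leq_sum => i _.
under [X in _ <= X]eq_bigr => x _ do rewrite big_distrr.
rewrite big_distrr exchange_big /= big_seq [X in _ <= X]big_seq; apply: leq_sum => p pi.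
have := ab i p pi; case: (a p) => [/(_ isT)|_]; first by rewrite muln1.
by rewrite muln0.
Qed.

Lemma eq_total (a b : pred (gwalk ggraph)) :
  (forall i p, p \in ps i -> a p = b p) -> total a = total b.
Proof. by move=> ab; apply: eq_bigr => i _; apply: eq_in_count => p; apply: ab. Qed.

Definition visits (w : gvert) (p : gwalk ggraph) : bool := w \in walk_vseq p.

Lemma total_visits w : w \notin gterms -> total (visits w) <= 1.
Proof.
move=> wT; have le1 i : count (visits w) (ps i) <= 1.
  apply: pairwise_count_le1 (ps_pairwise i) _ => p q pi qi.
  exact: Tpaths_share_edge (ps_Tpath pi) (ps_Tpath qi) wT.
rewrite /total; have [/existsP[i /hasP[p pi wp]]|/existsPn no] :=
    boolP [exists i, has (visits w) (ps i)].
  rewrite (bigD1 i) //= big1 ?addn0 // => j ji; apply/eqP; rewrite -leqn0 leqNgt -has_count.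
  apply/hasP => -[q qj wq]; have := Tpaths_share_edge (ps_Tpath pi) (ps_Tpath qj) wT wp wq.
  by rewrite (@ps_disjoint i j) // eq_sym.
by rewrite big1 // => i _; apply/eqP; rewrite -leqn0 leqNgt -has_count.
Qed.

(** This is 0 or 1: it tells whether the edge of the cubic multigraph at [z] carries an outer
    path. *)
Definition links z := total (fun p => outer p && (pvert z \in walk_vseq p)).

Lemma links_sigma z : links (sigma z) = links z.
Proof.
apply: eq_total => i p pi; case: (boolP (outer p)) => //= op.
by rewrite outer_sigma //; apply: ps_Tpath pi.
Qed.

Lemma pvertNT z : pvert z \notin gterms. Proof. by rewrite in_gterms. Qed.
Lemma cvertNT y : cvert y \notin gterms. Proof. by rewrite in_gterms. Qed.

Lemma total_sub (a b : pred (gwalk ggraph)) : (forall p, a p -> b p) -> total a <= total b.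
Proof. by move=> ab; apply: leq_sum => i _; apply: sub_count. Qed.

Lemma links_le1 z : links z <= 1.
Proof. by apply: leq_trans (total_visits (pvertNT z)); apply: total_sub => p /andP[]. Qed.

(** Each outer claw carries at most one path, and any other outer path occupies two ports. *)
Lemma total_outer : 2 * total outer <= 2 * (#|V| * d) + \sum_z links z.
Proof.
apply: leq_trans (total_sum_le (fun i p pi => @outer_vertices p (ps_Tpath pi))) _.
rewrite big_sumType /=; apply: leq_add; last first.
  by apply: leq_sum => z _; rewrite mul1n.
apply: leq_trans (_ : \sum_(c : V * 'I_d) 2 <= _); last first.
  by rewrite sum_nat_const card_prod card_ord mulnC.
apply: leq_sum => c _; rewrite -[X in _ <= X]muln1 leq_mul2l /=.
by apply: leq_trans (total_visits (cvertNT (inr c))); apply: total_sub => p /andP[].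
Qed.

(** A port that carries an outer path cannot also carry an inner one. *)
Lemma total_inner v : total (inner v) + \sum_i links (v, i) <= d.*2.+1 + 3.
Proof.
have := total_sum_le (fun i p pi => @inner_vertices v p (ps_Tpath pi)).
rewrite mul1n big_sumType /= => le1.
have le2 : \sum_(r < d.*2.+1) 1 * total (fun p => inner v p && (cvert (inl (v, r)) \in walk_vseq p))
    <= d.*2.+1.
  apply: leq_trans (_ : \sum_(r < d.*2.+1) 1 <= _); last by rewrite sum1_card card_ord.
  apply: leq_sum => r _; rewrite mul1n.
  by apply: leq_trans (total_visits (cvertNT (inl (v, r)))); apply: total_sub => p /andP[].
have le3 : \sum_i 1 * total (fun p => inner v p && (pvert (v, i) \in walk_vseq p)) +
    \sum_i links (v, i) <= 3.
  rewrite -big_split /=; apply: leq_trans (_ : \sum_(i : tri) 1 <= _); last first.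
    by rewrite sum1_card card_option card_bool.
  apply: leq_sum => i _; rewrite mul1n.
  apply: leq_trans (total_visits (pvertNT (v, i))).
  rewrite /links !totalE -big_split /=; apply: leq_sum => j _.
  rewrite -big_split /=; apply: leq_sum => p _; rewrite /inner /outer /visits.
  case: (_ \in _); rewrite ?andbF // !andbT.
  case: (node (source p) =P _) => [->|_]; last by rewrite /= add0n leq_b1.
  by case: (node (target p) =P _) => [->|_]; rewrite /= ?eqxx // add0n leq_b1.
apply: leq_trans (leq_add le1 (leqnn _)) _.
by rewrite -addnA; apply: leq_add le2 le3.
Qed.

(** Joining three terminals inside a gadget takes two inner paths, so a loose connector does not do
    it. *)
Definition loose i v := count (inner v) (ps i) <= 1.

Lemma loose_terminal i v : exists j, loose i v ->
  {in ps i, forall p, inner v p -> source p != term (v, j) /\ target p != term (v, j)}.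
Proof.
have [/hasP[p pi ip]|no] := boolP (has (inner v) (ps i)); last first.
  by exists None => _ p pi ip; case/hasP: no; exists p.
have snd3 (x : gvert) : exists i : tri, forall j, j != i -> x != term (v, j).
  case: x => [[t|z]|y]; [exists t.2|by exists None|by exists None].
  by move=> j; apply: contraNneq => -[->].
have [js jsP] := snd3 (source p); have [jt jtP] := snd3 (target p).
have [j /andP[jjs jjt]] := tri_third js jt; exists j.
rewrite /loose -size_filter => le1 q qi iq.
have : p \in filter (inner v) (ps i) by rewrite mem_filter ip.
have : q \in filter (inner v) (ps i) by rewrite mem_filter iq.
case: (filter _ _) le1 => [//|r [|//]] _; rewrite !inE => /eqP-> /eqP <-.
by split; [apply: jsP | apply: jtP].
Qed.

(** Each gadget is contracted, except that in a loose one the terminal from [loose_terminal] stays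
    separate. Only outer paths then join different classes. *)
Lemma connector_outer i : #|V| + \sum_v loose i v <= (count outer (ps i)).+1.
Proof.
have /fin_all_exists[j jP] := loose_terminal i.
pose f (x : gvert) : option (V + V) :=
  if x is inl (inl t) then
    Some (if loose i t.1 && (t.2 == j t.1) then inr t.1 else inl t.1)
  else None.
have le0 := @connector_contracted_edges ggraph gterms _ f _ (ps_conn i).
have le1 : count (fun p : gwalk ggraph => f (source p) != f (target p)) (ps i) <=
    count outer (ps i).
  apply: sub_in_count => p pi /=.
  have [_ _ /imsetP[t _ sp] /imsetP[t' _ tp] _] := ps_Tpath pi.
  rewrite /outer sp tp /=; apply: contraNN => /eqP[tt'].
  rewrite tt'; case: (boolP (loose i t'.1)) => [lv|]; last by rewrite eqxx.
  have ip : inner t'.1 p by rewrite /inner sp tp /= tt' eqxx.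
  have [] := jP _ lv _ pi ip; rewrite sp tp /= => ne ne'.
  have ne2 (u : V * tri) : u.1 = t'.1 -> term u != term (t'.1, j t'.1) -> u.2 == j t'.1 = false.
    by case: u => u1 u2 /= ->; apply: contraNF => /eqP ->.
  by rewrite (ne2 _ tt' ne) (ne2 _ erefl ne') eqxx.
suff le2 : #|V| + \sum_v loose i v <= #|f @: gterms|.
  by apply: leq_trans le2 (leq_trans le0 _).
pose A := [set u : V + V | if u is inr v then loose i v else true].
apply: leq_trans (_ : #|Some @: A| <= _).
  rewrite card_imset; last exact: Some_inj.
  rewrite -[X in _ <= X]sum1_card [X in _ <= X]big_mkcond big_sumType /=; apply: leq_add.
    by rewrite (eq_bigr (fun=> 1)) ?sum1_card // => v _; rewrite inE.
  by apply: leq_sum => v _; rewrite inE; case: (loose i v).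
apply: subset_leq_card; apply/subsetP => _ /imsetP[u uA ->].
case: u uA => v; rewrite inE => lv; apply/imsetP; last first.
  by exists (term (v, j v)); rewrite ?term_in //= lv eqxx.
have [q /andP[qj _]] := tri_third (j v) (j v).
by exists (term (v, q)); rewrite ?term_in //= (negbTE qj) andbF.
Qed.

(** Each connector that is not loose at [v] takes two of the inner paths bounded by
    [total_inner]. *)
Lemma sum_loose v : \sum_i links (v, i) <= 2 + 2 * \sum_i loose i v.
Proof.
have le1 : 2 * d.+1 <= total (inner v) + 2 * \sum_i loose i v.
  rewrite big_distrr /total -big_split /=.
  apply: leq_trans (_ : \sum_(i < d.+1) 2 <= _); last first.
    apply: leq_sum => i _; rewrite /loose.
    case: (leqP (count (inner v) (ps i)) 1) => cnt; last by rewrite muln0 addn0.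
    by rewrite muln1 leq_addl.
  by rewrite sum_nat_const card_ord mulnC.
have := total_inner v; move: (total _) (\sum_i links _) le1 => a b.
by move: (\sum_i _) => c; rewrite -muln2; lia.
Qed.

(** At each vertex, 2 plus twice the number of loose connectors minus the sum of [links] is
    non-negative. It is positive where that sum is 0, 1 or, by parity, 3. By [connector_outer] and
    [total_outer] its total over [V] is at most [2 * d.+1]. *)
Lemma few_defects : #|[set v | \sum_i links (v, i) != 2]| <= 2 * d.+1.
Proof.
have le1 : #|V| * d.+1 + \sum_i \sum_v loose i v <= total outer + d.+1.
  have -> : total outer + d.+1 = total outer + \sum_(i < d.+1) 1 by rewrite sum1_card card_ord.
  rewrite /total -big_split /=.
  apply: leq_trans (_ : \sum_(i < d.+1) (#|V| + \sum_v loose i v) <= _).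
    by rewrite big_split /= sum_nat_const card_ord mulnC.
  by apply: leq_sum => i _; rewrite addn1 connector_outer.
have le2 := total_outer.
have le3 : #|[set v | \sum_i links (v, i) != 2]| + \sum_z links z <=
    2 * #|V| + 2 * \sum_i \sum_v loose i v.
  rewrite [\sum_i \sum_v _]exchange_big /= -[#|[set v | _]|]sum1_card.
  rewrite [\sum_(v in [set v | _]) _]big_mkcond /=.
  have -> : \sum_z links z = \sum_v \sum_i links (v, i) by rewrite -sum_pair.
  have -> : #|V| = \sum_(v : V) 1 by rewrite sum1_card.
  rewrite !big_distrr /= -!big_split /=; apply: leq_sum => v _.
  rewrite inE; have := sum_loose v; rewrite muln1.
  have : \sum_i links (v, i) <= 3.
    by have le := links_le1; rewrite sum_tri (leq_add (leq_add (le _) (le _)) (le _)).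
  move: (\sum_i links (v, i)) (\sum_i loose i v) => a b; case: eqP => [->|] /=; lia.
move: le1 le2 le3; move: (total _) (\sum_i \sum_v loose i v) (\sum_z links z).
by move: #|[set v | _]| #|V| => e n a b c; nia.
Qed.

(** With [d = 0] there are no outer claws, so every outer path follows a link, and membership in [S]
    is constant along the connector. *)
Lemma links_closed (S : {set V}) : d = 0 ->
    (forall z, 0 < links z -> z.1 \in S -> (sigma z).1 \in S) ->
  S = set0 \/ S = setT.
Proof.
move=> d0 clS.
have clS' z : 0 < links z -> (z.1 \in S) = ((sigma z).1 \in S).
  move=> lz; apply/idP/idP; first exact: clS.
  by move=> szS; rewrite -[z]sigmaK clS // links_sigma.
pose f (x : gvert) := if x is inl (inl t) then t.1 \in S else false.
have fc : {in gterms &, forall x y, f x = f y}.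
  apply: (connector_constant (ps_conn ord0)) => p pi; have Tp := ps_Tpath pi.
  case: (TpathP Tp).
  - case=> [c|[c r]] t t' -> -> /= -> -> //.
    by have := ltn_ord r; rewrite {2}d0.
  - by move=> z t t' -> -> /= -> ->.
  move=> z t t' sp tp /= tz tz' vp; rewrite sp tp /= tz tz'; apply: clS'.
  rewrite /links /total (bigD1 ord0) //= addn_gt0 -has_count; apply/orP; left.
  apply/hasP; exists p => //; rewrite /outer sp tp vp /= !inE eqxx orbT andbT.
  by rewrite -[Some _ == _]/(t.1 == t'.1) tz tz' eq_sym sigma_node.
have [->|[v vS]] := set_0Vmem S; first by left.
right; apply/setP => u; rewrite in_setT.
by have := fc (term (u, None)) (term (v, None)) (term_in _) (term_in _); rewrite /= vS.
Qed.

End Obstruction.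

Lemma connectors_two_factor : has_disjoint_Tconnectors d.+1 gterms ->
  exists x : port -> bool,
    [/\ forall z, x (sigma z) = x z,
        #|[set v | \sum_i x (v, i) != 2]| <= 2 * d.+1
      & d = 0 -> forall S : {set V},
          (forall z, x z -> z.1 \in S -> (sigma z).1 \in S) -> S = set0 \/ S = setT].
Proof.
case=> C [conC disC]; have /fin_all_exists[ps psP] := conC.
have psT i p : p \in ps i -> is_Tpath gterms p by case: (psP i) => + _ _ _; apply.
have pspw i : pairwise (fun p q => [disjoint walk_edges p & walk_edges q]) (ps i).
  by case: (psP i).
have psdis i j p q : i != j -> p \in ps i -> q \in ps j ->
    [disjoint walk_edges p & walk_edges q].
  move=> ij pi qj; have := disC i j ij; rewrite /edge_disjoint.
  have sub i' p' : p' \in ps i' -> walk_edges p' \subset (C i').2.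
    by move=> p'i; case: (psP i') => _ _ -> _ /=; rewrite (big_rem p') //= subsetUl.
  by move=> disij; apply: disjointWl (sub i p pi) (disjointWr (sub j q qj) disij).
have psconn i :
    induced_connected (foldl (@shortcut ggraph) (uncut (walks_union (ps i))) (ps i)) gterms.
  by case: (psP i) => _ _ <-.
exists (fun z => 0 < links ps z); split.
- by move=> z; rewrite links_sigma.
- have eqx v i : (0 < links ps (v, i) : nat) = links ps (v, i).
    by have := links_le1 psT pspw psdis (v, i); case: (links _ _) => [|[]].
  under eq_finset => v do under eq_bigr => i _ do rewrite eqx.
  exact: few_defects.
- by move=> d0 S; apply: links_closed.
Qed.


(** * Edge-cuts in terms of claws and ports *)

Section Cut.

Variable X : {set gvert}.

Definition uniform b (z : port) :=
  [forall j, (j != z.2) ==> ((term (z.1, j) \in X) == b)].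

Definition split_port z := ~~ uniform true z && ~~ uniform false z.

(** Of two linked ports with terminals on opposite sides, only the one on the side of [X] counts, so
    that each link counts once. *)
Definition crossed_port z :=
  split_port z || uniform true z && uniform false (sigma z).

Definition crossed_claw (y : claw) :=
  [exists q, term (claw_node y q, q) \in X] &&
  [exists q, term (claw_node y q, q) \notin X].

Lemma mem_cut (e : edge ggraph) x y :
  ends e = [set x; y] -> (x \in X) != (y \in X) -> e \in cut (X : {set vert ggraph}).
Proof.
move=> eE xy; rewrite inE eE; apply/andP; split; apply/set0Pn.
  by case: (boolP (x \in X)) xy => xX; [exists x|exists y];
    rewrite !inE eqxx ?orbT ?xX //; case: (y \in X) xy.
by case: (boolP (x \in X)) xy => xX; [exists y|exists x];
  rewrite !inE eqxx ?orbT ?xX //; case: (y \in X) xy.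
Qed.

Lemma adj_claw_term y q : adj (cvert y) (term (claw_node y q, q)).
Proof. by rewrite /adj /= eqxx. Qed.

Lemma adj_port_term (z : port) j : j != z.2 -> adj (pvert z) (term (z.1, j)).
Proof. by move=> jz; rewrite /adj /= eqxx jz. Qed.

Lemma adj_ports z : adj (pvert z) (pvert (sigma z)).
Proof. by rewrite /adj /= eqxx. Qed.

Lemma uniform_contra z : uniform true z -> uniform false z -> False.
Proof.
have [j /andP[jz _]] := tri_third z.2 z.2.
by move=> /forallP/(_ j) + /forallP/(_ j); rewrite jz /= => /eqP->.
Qed.

Lemma uniform_mem b z : uniform b z -> exists2 j, j != z.2 & (term (z.1, j) \in X) = b.
Proof.
have [j /andP[jz _]] := tri_third z.2 z.2.
by move=> /forallP/(_ j); rewrite jz => /eqP; exists j.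
Qed.

Lemma uniformN b z : ~~ uniform b z -> exists2 j, j != z.2 & (term (z.1, j) \in X) = ~~ b.
Proof.
rewrite negb_forall => /existsP[j]; rewrite negb_imply => /andP[jz ne].
by exists j => //; case: b ne; case: (_ \in _).
Qed.

(* The crossing claw or port that an edge at [x] is charged to; a crossing link
   is charged to its end on the side of [X]. *)
Definition label (x : gvert) : option (claw + port) :=
  match x with
  | inl (inr z) => Some (inr (if uniform false z && uniform true (sigma z) then sigma z else z))
  | inr (inl y) => Some (inl y)
  | _ => None
  end.

Definition charged (i : claw + port) (e : edge ggraph) : Prop :=
  (exists2 x, x \in ends e & label x = Some i) /\
  (forall x, x \in ends e -> label x = None \/ label x = Some i).

Lemma charged_ends i (e : edge ggraph) x y : ends e = [set x; y] ->
  label x = Some i -> label y = None \/ label y = Some i -> charged i e.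
Proof.
move=> eE lx ly; split; first by exists x; rewrite // eE set21.
by move=> u; rewrite eE => /set2P[] ->; [right|].
Qed.

(** Wherever the non-terminals lie, a crossed claw or port forces a cut edge, from which [label]
    recovers it. *)
Lemma crossed_cut :
  #|[set y | crossed_claw y]| + #|[set z | crossed_port z]| <=
  #|cut (X : {set vert ggraph})|.
Proof.
pose A := [set i : claw + port |
  match i with inl y => crossed_claw y | inr z => crossed_port z end].
have -> : #|[set y | crossed_claw y]| + #|[set z | crossed_port z]| = #|A|.
  by rewrite !card_set_sum [RHS]big_sumType.
apply: (@leq_card_rel _ _ _ _ charged).
  case=> [y|z]; rewrite inE.
    case/andP => /existsP[q qX] /existsP[q' q'X].
    have [u uX] : exists u, (cvert y \in X) != (term (claw_node y u, u) \in X).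
      by case: (boolP (cvert y \in X)) => _; [exists q'|exists q]; rewrite ?qX ?(negbTE q'X).
    have [e eE] := adj_edge (adj_claw_term y u).
    by exists e; [apply: mem_cut eE uX | apply: charged_ends eE _ _; [|left]].
  case/orP => [/andP[uzt uzf]|/andP[uz usz]].
    have [j' j'z j'X] := uniformN uzt; have [j jz jX] := uniformN uzf.
    have [u uz uX] : exists2 u, u != z.2 & (pvert z \in X) != (term (z.1, u) \in X).
      by case: (boolP (pvert z \in X)) => _; [exists j'|exists j]; rewrite ?jX ?j'X.
    have [e eE] := adj_edge (adj_port_term uz).
    exists e; first exact: mem_cut eE uX.
    by apply: charged_ends eE _ _; [rewrite /= (negbTE uzf)|left].
  have lz : label (pvert z) = Some (inr z).
    by rewrite /=; case: ifP => // /andP[/(uniform_contra uz)].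
  have lsz : label (pvert (sigma z)) = Some (inr z) by rewrite /= sigmaK usz uz.
  have [j jz jX] := uniform_mem uz; have [j' jz' jX'] := uniform_mem usz.
  (* The walk from a terminal in [X] over both ports to a terminal outside changes sides at one of
     its three edges. *)
  case: (boolP (pvert z \in X)) => zX; last first.
    have [e eE] := adj_edge (adj_port_term jz).
    exists e; first by apply: mem_cut eE _; rewrite (negbTE zX) jX.
    by apply: charged_ends eE lz _; left.
  case: (boolP (pvert (sigma z) \in X)) => szX.
    have [e eE] := adj_edge (adj_port_term jz').
    exists e; first by apply: mem_cut eE _; rewrite szX jX'.
    by apply: charged_ends eE lsz _; left.
  have [e eE] := adj_edge (adj_ports z).
  exists e; first by apply: mem_cut eE _; rewrite zX (negbTE szX).
  by apply: charged_ends eE lz _; right.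
move=> i i' e _ _ [[x xe lx] _] [_ /(_ x xe)].
by rewrite lx; case=> // -[].
Qed.

Definition mixed v := [exists j, term (v, j) \in X] && [exists j, term (v, j) \notin X].

Definition outer_crossed c :=
  [exists q, term (tau q c, q) \in X] && [exists q, term (tau q c, q) \notin X].

Lemma mixed_cut :
  #|[set v | mixed v]| * d.*2.+1 + #|[set c | outer_crossed c]| * d +
    #|[set z | crossed_port z]| <= #|cut (X : {set vert ggraph})|.
Proof.
apply: leq_trans crossed_cut; rewrite leq_add2r !card_set_sum big_sumType /=.
have sumV n (F : V -> bool) : (\sum_v F v) * n = \sum_(c : V * 'I_n) F c.1.
  rewrite big_distrl /= -(pair_bigA _ (fun v (r : 'I_n) => F v : nat)) /=.
  by apply: eq_bigr => v _; rewrite sum_nat_const card_ord mulnC.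
by rewrite !sumV.
Qed.

Lemma nmixed v j j' : ~~ mixed v -> (term (v, j) \in X) = (term (v, j') \in X).
Proof.
rewrite negb_and !negb_exists => /orP[] /forallP no.
  by rewrite (negbTE (no j)) (negbTE (no j')).
by have := no j; have := no j'; rewrite !negbK => -> ->.
Qed.

(** Of three terminals on two sides, one is alone: [j0] is its index and [b] its membership in
    [X]. *)
Lemma mixed_minority v : mixed v -> exists j0 b, forall j,
  (term (v, j) \in X) = (if j == j0 then b else ~~ b).
Proof.
case/andP => /existsP[i iX] /existsP[i' i'X].
pose a j := term (v, j) \in X; rewrite -/(a i) -/(a i') in iX i'X.
have : exists j0 b, forall j, a j = (if j == j0 then b else ~~ b).
  case e0 : (a None); case e1 : (a (Some true)); case e2 : (a (Some false)).
  - by move: i'X; case: i' => [[]|]; rewrite ?e0 ?e1 ?e2.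
  - by exists (Some false), false => -[[]|]; rewrite ?e0 ?e1 ?e2.
  - by exists (Some true), false => -[[]|]; rewrite ?e0 ?e1 ?e2.
  - by exists None, true => -[[]|]; rewrite ?e0 ?e1 ?e2.
  - by exists None, false => -[[]|]; rewrite ?e0 ?e1 ?e2.
  - by exists (Some true), true => -[[]|]; rewrite ?e0 ?e1 ?e2.
  - by exists (Some false), true => -[[]|]; rewrite ?e0 ?e1 ?e2.
  - by move: iX; case: i => [[]|]; rewrite ?e0 ?e1 ?e2.
by [].
Qed.

Lemma minority_split v j0 b i :
    (forall j, (term (v, j) \in X) = (if j == j0 then b else ~~ b)) ->
  i != j0 -> split_port (v, i).
Proof.
move=> vE ij0; have [q /andP[qi qj0]] := tri_third i j0.
apply/andP; split; apply/negP => /forallP /= un.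
  have := un q; have := un j0; rewrite !vE eqxx (negbTE qj0) qi eq_sym ij0 /=.
  by case: b {vE}.
have := un q; have := un j0; rewrite !vE eqxx (negbTE qj0) qi eq_sym ij0 /=.
by case: b {vE}.
Qed.

(** A link leaving [N] is charged to its end in [N], or to the mate when only the mate is split. *)
Lemma crossed_ports_ge (N : {set V}) :
    (forall z, split_port z || uniform (z.1 \in N) z) ->
  #|[set z | (z.1 \in N) && ((sigma z).1 \notin N)]| <= #|[set z | crossed_port z]|.
Proof.
move=> HN; apply: (@leq_card_rel _ _ _ _ (fun z z' => z' = z \/ z' = sigma z)).
  move=> z; rewrite inE => /andP[zN szN].
  have [spz|nspz] := boolP (split_port z).
    by exists z; [rewrite inE /crossed_port spz | left].
  have [spsz|nspsz] := boolP (split_port (sigma z)).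
    by exists (sigma z); [rewrite inE /crossed_port spsz | right].
  exists z; last by left.
  have := HN z; have := HN (sigma z); rewrite inE /crossed_port (negbTE nspz) (negbTE nspsz).
  by rewrite zN (negbTE szN) /= => -> ->.
move=> z z' u; rewrite !inE => /andP[zN szN] /andP[z'N sz'N].
case=> -> [] // e; first by rewrite e (negbTE sz'N) in zN.
  by rewrite e z'N in szN.
exact: (can_inj sigmaK).
Qed.

End Cut.

(** * Edge-connectivity of the terminals *)

Hypothesis tau_inj : forall q, injective (tau q).

(** A cut without mixed gadgets is a cut of the cubic multigraph with the hyperedges weighted by
    [d]. Two mixed gadgets alone give [2 * d.*2.+1 + 2] cut edges. A single mixed gadget is moved to
    its majority side, and its own claws pay for the change. *)
Lemma gterms_edge_connected :
    (forall N : {set V}, N != set0 -> N != setT ->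
       3 * d.+1 <=
         d * #|[set c | [exists q, tau q c \in N] && [exists q, tau q c \notin N]]| +
         #|[set z : port | (z.1 \in N) && ((sigma z).1 \notin N)]|) ->
  edge_connected_in (3 * d.+1) gterms.
Proof.
move=> Hcut X x y /imsetP[t _ ->] /imsetP[t' _ ->] tX t'X.
apply: leq_trans (mixed_cut X); rewrite -muln2.
have [/existsP[v mv]|/existsPn nm] := boolP [exists v, mixed X v]; last first.
  pose N := [set v | term (v, None) \in X].
  have FN (u : V * tri) : (term u \in X) = (u.1 \in N).
    by case: u => u q; rewrite inE; apply: nmixed.
  have HN z : split_port X z || uniform X (z.1 \in N) z.
    by apply/orP; right; apply/forallP => j; rewrite FN eqxx implybT.
  have := crossed_ports_ge HN; have := Hcut N.
  have -> : N != set0 by apply/set0Pn; exists t.1; rewrite -FN.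
  have -> : N != setT by apply: contraNneq t'X => NT; rewrite FN NT inE.
  move=> /(_ isT isT); set h := [set c | _ && _]; set h' := [set c | outer_crossed X c].
  have -> : h = h'.
    apply/setP => c; rewrite !inE /outer_crossed.
    by congr (_ && _); apply: eq_existsb => q; rewrite FN.
  move: #|h'| #|[set z | crossed_port X z]| #|_| #|_| => *; nia.
have [j0 [b vE]] := mixed_minority mv.
have [/existsP[w /andP[wv mw]]|/existsPn nw] := boolP [exists w, (w != v) && mixed X w].
  have [j1 [b1 wE]] := mixed_minority mw.
  have [i /andP[ij0 _]] := tri_third j0 j0; have [i1 /andP[ij1 _]] := tri_third j1 j1.
  have le1 : 1 < #|[set u | mixed X u]|.
    apply: leq_trans (_ : #|[set v; w]| <= _); first by rewrite cards2 eq_sym wv.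
    by apply: subset_leq_card; apply/subsetP => u /set2P[] ->; rewrite inE.
  have le2 : 1 < #|[set z | crossed_port X z]|.
    apply: leq_trans (_ : #|[set (v, i); (w, i1)]| <= _).
      by rewrite cards2 xpair_eqE eq_sym (negbTE wv).
    apply: subset_leq_card; apply/subsetP => u /set2P[] ->; rewrite inE /crossed_port.
      by rewrite (minority_split vE).
    by rewrite (minority_split wE).
  move: #|_| #|_| #|_| le1 le2 => a1 a2 a3; nia.
have nm w : w != v -> ~~ mixed X w by move=> wv; have := nw w; rewrite wv.
have le1 : 0 < #|[set u | mixed X u]| by apply/card_gt0P; exists v; rewrite inE.
have [j1 /andP[j10 _]] := tri_third j0 j0.
(* [j1] is a majority index at [v]; in every other gadget the terminals agree. *)
pose N := [set w | term (w, j1) \in X].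
have vN : (v \in N) = ~~ b by rewrite inE vE (negbTE j10).
have FN (u : V * tri) : u != (v, j0) -> (term u \in X) = (u.1 \in N).
  case: u => u q; have [-> /=|uv _] := eqVneq u v; last by rewrite inE; apply/nmixed/nm.
  by rewrite vN vE xpair_eqE eqxx /= => /negbTE ->.
have [c0 c0E] : exists c0, tau j0 c0 = v.
  by have [g _ gK] := injF_bij (@tau_inj j0); exists (g v).
have HN z : split_port X z || uniform X (z.1 \in N) z.
  case: z => u i; have [/andP[/eqP -> ij0]|nvi] := boolP ((u == v) && (i != j0)).
    by rewrite (minority_split vE).
  apply/orP; right; apply/forallP => j; apply/implyP => /= ji; apply/eqP/FN.
  by apply: contraNneq nvi => -[-> jj0]; rewrite eqxx -jj0 eq_sym.
(* If [N] is trivial, the [d.*2.+1] claws of [v], the [d] claws of [c0] and two split ports give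
   exactly [3 * d.+1]. *)
have [triv|ntriv] := boolP ((N == set0) || (N == setT)).
  have NE u : (u \in N) = ~~ b.
    by rewrite -vN; case/orP: triv => /eqP ->; rewrite !inE.
  have le2 : 0 < #|[set c | outer_crossed X c]|.
    apply/card_gt0P; exists c0; rewrite inE.
    have a0 : (term (tau j0 c0, j0) \in X) = b by rewrite c0E vE eqxx.
    have a1 : (term (tau j1 c0, j1) \in X) = ~~ b.
      by rewrite FN ?NE // xpair_eqE (negbTE j10) andbF.
    by apply/andP; split; apply/existsP; case: (b) a0 a1 => a0 a1;
      [exists j0|exists j1|exists j1|exists j0]; rewrite ?a0 ?a1.
  have le3 : 1 < #|[set z | crossed_port X z]|.
    have [j2 /andP[j20 j21]] := tri_third j0 j1.
    apply: leq_trans (_ : #|[set (v, j1); (v, j2)]| <= _).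
      by rewrite cards2 xpair_eqE eqxx /= eq_sym j21.
    by apply: subset_leq_card; apply/subsetP => u /set2P[] ->; rewrite inE /crossed_port
      (minority_split vE).
  move: #|_| #|_| #|_| le1 le2 le3 => a1 a2 a3; nia.
have := crossed_ports_ge HN; have := Hcut N.
move: ntriv; rewrite negb_or => /andP[-> ->] /(_ isT isT).
set h := [set c | _ && _]; set h' := [set c | outer_crossed X c].
(* Only the hyperedge [c0] contains the minority terminal, so no other one is affected by the
   move. *)
have le2 : #|h| <= #|h'|.+1.
  rewrite -add1n -(cards1 c0); apply: leq_trans (leq_card_setU _ _).
  apply: subset_leq_card; apply/subsetP => c; rewrite !inE /outer_crossed.
  have [//|cc0] /= := eqVneq c c0.
  have FNc q : (term (tau q c, q) \in X) = (tau q c \in N).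
    apply: FN; apply: contraNneq cc0 => -[+ qj0]; rewrite qj0 -c0E.
    by move/tau_inj ->.
  by case/andP => /existsP[q qN] /existsP[q' q'N]; apply/andP; split; apply/existsP;
    [exists q|exists q']; rewrite FNc.
have le3 : d * #|h| <= d + #|h'| * d by rewrite -mulSn mulnC leq_mul2r le2 orbT.
have := leq_pmull (d * 2).+1 le1 => le4 le5 le6.
apply: leq_trans le5 _; apply: leq_trans (leq_add le3 le6) _.
rewrite leq_add2r leq_add2r; apply: leq_trans le4; lia.
Qed.

End Construction.

(** * At least two connectors *)

Lemma gtgraph_iso_pad (V : finType) (sigma : V * tri -> V * tri) (tau : tri -> V -> V)
    (d m m' : nat) (sigma_node : forall z, (sigma z).1 != z.1) :
  tgraph_iso (gtgraph tau d m sigma_node) (gtgraph tau d m' sigma_node) -> m = m'.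
Proof.
case=> f [g [/bij_eq_card + _ _ _]]; rewrite /= !card_sum !card_ord.
by move=> /eqP; rewrite !eqn_add2l => /eqP.
Qed.

(** * Copies of a cubic multigraph without 2-factor *)

Section SylvesterBlocks.

(* The 10-vertex cubic multigraph with a cut vertex [None] joined by three
   bridges to the triples [(t, None), (t, Some false), (t, Some true)]; the last
   two vertices of a triple are joined by a double edge. *)
Definition block : finType := option (tri * tri).

Definition block_sigma (p : block) (i : tri) : block * tri :=
  match p, i with
  | None, _ => (Some (i, None), None)
  | Some (t, None), None => (None, t)
  | Some (t, None), Some b => (Some (t, Some b), None)
  | Some (t, Some b), None => (Some (t, None), Some b)
  | Some (t, Some b), Some c => (Some (t, Some (~~ b)), Some c)
  end.

Lemma block_sigmaK p i : block_sigma (block_sigma p i).1 (block_sigma p i).2 = (p, i).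
Proof. by case: p i => [[t [b|]]|] [c|] //=; rewrite negbK. Qed.

Lemma block_sigma_node p i : (block_sigma p i).1 != p.
Proof. by case: p i => [[[[]|] [[]|]]|] [c|]. Qed.

Lemma block_connected (S : pred block) :
  (forall p i, S p -> S (block_sigma p i).1) -> forall p p', S p -> S p'.
Proof.
move=> clS.
have toN p : S p -> S None.
  case: p => [[t [b|]]|] // Sp; last exact: (clS _ None Sp).
  exact: (clS (Some (t, None)) None (clS _ None Sp)).
have ofN p : S None -> S p.
  case: p => [[t [b|]]|] // SN; last exact: (clS _ t SN).
  exact: (clS (Some (t, None)) (Some b) (clS _ t SN)).
by move=> p p' /toN /ofN.
Qed.

(* In a 2-factor the bridges would be unused by parity, which isolates the cut vertex. *)
Lemma block_no_two_factor (x : block -> tri -> bool) :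
    (forall p i, x (block_sigma p i).1 (block_sigma p i).2 = x p i) ->
  exists p, \sum_i x p i != 2.
Proof.
move=> xs; apply/existsP; apply: contraT; rewrite negb_exists => /forallP deg.
have bridge t : x None t = false.
  have := deg (Some (t, None)); have := deg (Some (t, Some false)).
  have := deg (Some (t, Some true)); rewrite !sum_tri.
  have := xs None t; have := xs (Some (t, None)) (Some false).
  have := xs (Some (t, None)) (Some true).
  have := xs (Some (t, Some false)) (Some false); have := xs (Some (t, Some false)) (Some true).
  move=> /= -> -> -> -> ->.
  by do 5![case: (x _ _)].
by have := deg None; rewrite sum_tri !bridge.
Qed.

Variable n : nat.
Hypothesis n_gt2 : 2 < n.

Definition bnode : finType := ('I_n * block)%type.

Definition bsigma (z : bnode * tri) : bnode * tri :=
  ((z.1.1, (block_sigma z.1.2 z.2).1), (block_sigma z.1.2 z.2).2).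

(** The hyperedges are the triples of cyclically consecutive copies of one block vertex. *)
Definition btau (q : tri) (c : bnode) : bnode :=
  (match q with None => c.1 | Some false => ordS c.1 | Some true => ordS (ordS c.1) end, c.2).

Lemma bsigmaK : involutive bsigma.
Proof. by case=> [[j p] i]; rewrite /bsigma /= block_sigmaK. Qed.

Lemma bsigma_node z : (bsigma z).1 != z.1.
Proof. by case: z => [[j p] i]; rewrite xpair_eqE eqxx block_sigma_node. Qed.

Lemma ordS_neq (j : 'I_n) : ordS j != j.
Proof.
rewrite -val_eqE /=; have := ltn_ord j => jn.
case: (ltnP j.+1 n) => [lt|ge]; first by rewrite modn_small //; lia.
by rewrite -(subnKC ge) modnDl modn_small; lia.
Qed.

Lemma ordSS_neq (j : 'I_n) : ordS (ordS j) != j.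
Proof.
rewrite -val_eqE /= -[(_ %% n).+1]addn1 modnDml addn1; have := ltn_ord j => jn.
case: (ltnP j.+2 n) => [lt|ge]; first by rewrite modn_small //; lia.
by rewrite -(subnKC ge) modnDl modn_small; lia.
Qed.

Lemma btau_neq q q' c : q != q' -> btau q c != btau q' c.
Proof.
have nS := ordS_neq; have nSS := ordSS_neq.
case: q q' => [[]|] [[]|] // _; rewrite xpair_eqE eqxx andbT ?nS ?nSS //=;
  by rewrite eq_sym ?nS ?nSS.
Qed.

Lemma btau_inj q : injective (btau q).
Proof.
move=> [j p] [j' p'] e; have /= -> := congr1 snd e; have /= := congr1 fst e.
by case: q {e} => [[]|] => [/ordS_inj/ordS_inj|/ordS_inj|] ->.
Qed.

(** Modulo [n], [j' + (n - j)] successor steps lead from [j] to [j'], whichever is larger. *)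
Lemma ordS_closed (S : pred 'I_n) : (forall j, S j -> S (ordS j)) -> forall j j', S j -> S j'.
Proof.
move=> clS j j' Sj; have it k : S (iter k (@ordS n) j) by elim: k => //= k; apply: clS.
have -> : j' = iter (j' + (n - j)) (@ordS n) j; last exact: it.
have vit k : val (iter k (@ordS n) j) = (j + k) %% n.
  elim: k => [|k IH] /=; first by rewrite addn0 modn_small.
  by rewrite IH -[(_ %% n).+1]addn1 modnDml addn1 addnS.
apply: val_inj; rewrite vit /= addnCA subnKC; last exact: ltnW.
by rewrite modnDr modn_small.
Qed.

(** * Cuts of the joined copies *)

Section BlockCut.

Variable N : {set bnode}.

Definition hcross := [set c | [exists q, btau q c \in N] && [exists q, btau q c \notin N]].
Definition lcross := [set z : bnode * tri | (z.1 \in N) && ((bsigma z).1 \notin N)].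

(** Around the cycle some step at [u] leaves [N] and some step at [w] enters it. The triples
    starting at [u], [w] or their predecessors all cross, and at least three of these starts are
    distinct. *)
Lemma hcross_row p j j' : (j, p) \in N -> (j', p) \notin N ->
  2 < #|[set c in hcross | c.2 == p]|.
Proof.
move=> jN j'N.
have step (R : pred 'I_n) k k' : R k -> ~~ R k' -> exists2 u, R u & ~~ R (ordS u).
  move=> Rk Rk'; have /existsP[u /andP[]] : [exists u, R u && ~~ R (ordS u)]; last by exists u.
  apply: contraNT Rk'; rewrite negb_exists => /forallP cl.
  by apply: ordS_closed Rk => u Ru; have := cl u; rewrite Ru negbK.
have [u uN suN] := step (fun k => (k, p) \in N) _ _ jN j'N.
have [w wN swN] : exists2 w, (w, p) \notin N & (ordS w, p) \in N.
  have [|w ? ?] := step (fun k => (k, p) \notin N) _ j j'N; first by rewrite negbK.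
  by exists w => //; rewrite -[_ \in _]negbK.
have cross a b q q' : btau q (a, p) = (b, p) -> btau q' (a, p) = (ordS b, p) ->
    ((b, p) \in N) != ((ordS b, p) \in N) -> (a, p) \in [set c in hcross | c.2 == p].
  move=> qE q'E ne; rewrite !inE /= eqxx andbT; apply/andP; split; apply/existsP.
    by case: (boolP ((b, p) \in N)) ne => bN;
      [exists q; rewrite qE|exists q'; rewrite q'E; case: (_ \in _) ne].
  by case: (boolP ((b, p) \in N)) ne => bN;
    [exists q'; rewrite q'E; case: (_ \in _) ne|exists q; rewrite qE].
have ne1 : ((u, p) \in N) != ((ordS u, p) \in N) by rewrite uN (negbTE suN).
have ne2 : ((w, p) \in N) != ((ordS w, p) \in N) by rewrite swN (negbTE wN).
have cu := cross u u None (Some false) erefl erefl ne1.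
have cw := cross w w None (Some false) erefl erefl ne2.
have cu' : (ord_pred u, p) \in [set c in hcross | c.2 == p].
  by apply: (cross _ u (Some false) (Some true)) ne1; rewrite /btau /= ord_predK.
have cw' : (ord_pred w, p) \in [set c in hcross | c.2 == p].
  by apply: (cross _ w (Some false) (Some true)) ne2; rewrite /btau /= ord_predK.
have uw : u != w by apply: contraNneq wN => <-.
have three a b c : (a, p) \in [set c in hcross | c.2 == p] ->
    (b, p) \in [set c in hcross | c.2 == p] -> (c, p) \in [set c in hcross | c.2 == p] ->
    a != b -> a != c -> b != c -> 2 < #|[set c in hcross | c.2 == p]|.
  move=> ha hb hc ab ac bc.
  apply: leq_trans (_ : #|(a, p) |: [set (b, p); (c, p)]| <= _).
    by rewrite cardsU1 cards2 !inE !xpair_eqE !eqxx !andbT bc (negbTE ab) (negbTE ac).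
  by apply: subset_leq_card; apply/subsetP => x /setU1P[|/set2P[]] ->.
have prneq (a : 'I_n) : a != ord_pred a by rewrite -{1}[a]ord_predK ordS_neq.
have [pw|npw] := eqVneq w (ord_pred u); last exact: three cu cw cu' uw (prneq u) npw.
apply: three cu cw cw' uw _ (prneq w).
by rewrite pw -{1}[u]ord_predK -{1}[ord_pred u]ord_predK ordSS_neq.
Qed.

(** If not every copy has a cut link, some copy [j0] lies on one side. A row, meaning all copies of
    one block vertex, that is split gives three crossed hyperedges. Two such rows suffice since [d]
    is positive; if there is only one, a vertex of it opposite to [j0] has three cut links. *)
Lemma block_cut d : n = 3 * d.+1 -> 0 < d -> N != set0 -> N != setT ->
  3 * d.+1 <= d * #|hcross| + #|lcross|.
Proof.
move=> nE d0 N0 NT.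
have [/forallP allc|] := boolP [forall j, exists z in lcross, z.1.1 == j].
  suff : n <= #|lcross| by lia.
  rewrite -[n in n <= _]card_ord -cardsT; apply: leq_trans (leq_imset_card (fun z => z.1.1) lcross).
  apply: subset_leq_card; apply/subsetP => j _; have /exists_inP[z zl /eqP <-] := allc j.
  exact: imset_f.
rewrite negb_forall => /existsP[j0 /exists_inPn noc].
have unif p p' : ((j0, p) \in N) = ((j0, p') \in N).
  suff cl a b : (j0, a) \in N -> (j0, b) \in N by apply/idP/idP; apply: cl.
  apply: (block_connected (S := fun a => (j0, a) \in N)) => {}a i aN.
  by apply: contraT => sN; have := noc ((j0, a), i); rewrite inE aN sN eqxx => /(_ isT).
have [j [p jp]] : exists j p, ((j, p) \in N) != ((j0, None) \in N).
  have [j0N|j0N] := boolP ((j0, None) \in N).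
    have /existsP[[j p] jp] : [exists v, v \notin N].
      apply: contraNT NT; rewrite negb_exists => /forallP al.
      by apply/eqP/setP => v; rewrite inE; apply/negPn.
    by exists j, p; rewrite (negbTE jp).
  by have /set0Pn[[j p] jp] := N0; exists j, p; rewrite jp.
have proper_row : 2 < #|[set c in hcross | c.2 == p]|.
  by move: jp; rewrite (unif None p); case: (boolP ((j, p) \in N)) => jN;
    case: (boolP ((j0, p) \in N)) => j0N // _;
    [apply: hcross_row jN j0N|apply: hcross_row j0N jN].
have subh p' : #|[set c in hcross | c.2 == p']| <= #|hcross|.
  by apply: subset_leq_card; apply/subsetP => c; rewrite inE => /andP[].
have [/existsP[p' /andP[pp' /existsP[k kN]]]|norow] :=
    boolP [exists p', (p' != p) && [exists k, ((k, p') \in N) != ((j0, p') \in N)]].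
  have row' : 2 < #|[set c in hcross | c.2 == p']|.
    by move: kN; case: (boolP ((k, p') \in N)) => kN; case: (boolP ((j0, p') \in N)) => j0N // _;
    [apply: hcross_row kN j0N|apply: hcross_row j0N kN].
  have : 5 < #|hcross|; last by nia.
  apply: leq_trans (leq_add proper_row row') _; rewrite -cardsUI.
  rewrite (_ : _ :&: _ = set0) ?cards0 ?addn0.
    by apply: subset_leq_card; apply/subsetP => c; rewrite !inE -andb_orr => /andP[].
  apply/setP => c; rewrite !inE; case: eqP => [->|]; last by rewrite andbF.
  by rewrite [p == p']eq_sym (negbTE pp') !andbF.
have side p' k : p' != p -> ((k, p') \in N) = ((j0, None) \in N).
  move=> pp'; rewrite (unif None p'); apply/eqP; apply: contraNT norow => ne.
  by apply/existsP; exists p'; rewrite pp'; apply/existsP; exists k.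
have nb i : ((bsigma ((j, p), i)).1 \in N) = ((j0, None) \in N).
  by apply: side; apply: block_sigma_node.
have : 2 < #|lcross|; last by have := subh p; nia.
pose f (i : tri) := if (j, p) \in N then ((j, p), i) else bsigma ((j, p), i).
have finj : injective f.
  by move=> i i'; rewrite /f; case: ifP => _ => [[]|/(can_inj bsigmaK)[]].
have card3 : #|tri| = 3 by rewrite card_option card_bool.
rewrite -card3 -(card_imset _ finj); apply: subset_leq_card; apply/subsetP.
move=> _ /imsetP[i _ ->]; rewrite /f inE; case: ifP => jN.
  by rewrite jN nb; move: jp; rewrite jN; case: (_ \in _).
by rewrite bsigmaK jN nb; move: jp; rewrite jN; case: (_ \in _).
Qed.

End BlockCut.

End SylvesterBlocks.

(** Each of the [3 * d.+1] copies contains a defect, but [d.+1] connectors allow only [2 * d.+1]. *)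
Lemma many_connectors_counterexample d : 0 < d ->
  exists F : nat -> tgraph,
    (forall i j : nat, i <> j -> ~ tgraph_iso (F i) (F j)) /\
    (forall i : nat,
       edge_connected_in (3 * d.+1) (terms (F i)) /\
       ~ has_disjoint_Tconnectors d.+1 (terms (F i))).
Proof.
move=> d0; pose n := 3 * d.+1; have n2 : 2 < n by rewrite /n; lia.
exists (fun m => gtgraph (@btau n) d m (@bsigma_node n)); split.
  by move=> i j ij /gtgraph_iso_pad.
move=> m; split.
  apply: (gterms_edge_connected (@bsigmaK n)); first exact: btau_inj.
  by move=> N N0 NT; apply: block_cut.
move=> /(connectors_two_factor (@bsigmaK n) (btau_neq n2)) [x [xs bad _]].
suff : n <= #|[set v | \sum_i x (v, i) != 2]| by move: bad; rewrite /n; lia.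
rewrite -[n in n <= _]card_ord -cardsT; apply: leq_trans (leq_imset_card fst _).
apply: subset_leq_card; apply/subsetP => j _.
have [|p pP] := @block_no_two_factor (fun p i => x ((j, p), i)).
  by move=> p i; rewrite -[RHS]xs.
by apply/imsetP; exists (j, p); rewrite ?inE.
Qed.

(** * A single connector *)

Section PetersenBlocks.

(* The Petersen graph minus a vertex: [(i, None)] are the neighbours of the
   deleted vertex, and the other vertices form the 6-cycle in which
   [(i, Some false)] and [(i, Some true)] have positions [i] and [i + 3]. *)
Definition pet : finType := (tri * tri)%type.

Definition pnext (i : tri) (c : bool) : pet :=
  match i with
  | None => (Some false, Some c)
  | Some false => (Some true, Some c)
  | Some true => (None, Some (~~ c))
  end.

Definition pprev (i : tri) (c : bool) : pet :=
  match i with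
  | None => (Some true, Some (~~ c))
  | Some false => (None, Some c)
  | Some true => (Some false, Some c)
  end.

Definition pleg (w : pet) (q : tri) : bool := (w.2 == None) && (q == None).

(* The value at a leg is irrelevant. *)
Definition pstep (w : pet) (q : tri) : pet * tri :=
  match w.2, q with
  | None, None => (w, None)
  | None, Some c => ((w.1, Some c), None)
  | Some c, None => ((w.1, None), Some c)
  | Some c, Some true => (pnext w.1 c, Some false)
  | Some c, Some false => (pprev w.1 c, Some true)
  end.

Definition pnode : finType := ((bool * bool) * pet)%type.

(** Leg [i] adds a non-zero vector of the plane over the two-element field; the three vectors give
    the three perfect matchings of K4. *)
Definition opposite (b : bool * bool) (i : tri) : bool * bool :=
  match i with
  | None => (~~ b.1, b.2)
  | Some false => (b.1, ~~ b.2)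
  | Some true => (~~ b.1, ~~ b.2)
  end.

Definition psigma (z : pnode * tri) : pnode * tri :=
  let: ((b, w), q) := z in
  if pleg w q then ((opposite b w.1, w), q) else ((b, (pstep w q).1), (pstep w q).2).

Definition ptau (q : tri) (v : pnode) : pnode :=
  match q with
  | None => v
  | Some false => ((~~ v.1.1, v.1.2), v.2)
  | Some true => ((v.1.1, ~~ v.1.2), v.2)
  end.

Lemma psigmaK : involutive psigma.
Proof.
case=> [[[b1 b2] [i k]] q].
by case: b1; case: b2; case: i => [[]|]; case: k => [[]|]; case: q => [[]|].
Qed.

Lemma psigma_node z : (psigma z).1 != z.1.
Proof.
case: z => [[[b1 b2] [i k]] q].
by case: b1; case: b2; case: i => [[]|]; case: k => [[]|]; case: q => [[]|].
Qed.

Lemma ptau_neq q q' v : q != q' -> ptau q v != ptau q' v.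
Proof.
case: v => [[b1 b2] w]; case: q q' => [[]|] [[]|] //= _;
  by rewrite !xpair_eqE; case: b1; case: b2.
Qed.

Lemma ptau_inj q : injective (ptau q).
Proof.
apply: inv_inj => -[[b1 b2] w].
by case: q => [[]|]; rewrite /= ?negbK.
Qed.

(** The cut edges of [f] inside a block, each counted once from its end in [f]. *)
Definition pinner (f : pet -> bool) : nat :=
  \sum_i \sum_k \sum_q [&& ~~ pleg (i, k) q, f (i, k) & ~~ f (pstep (i, k) q).1].

(** A cut separating the leg vertices has at least two edges inside the block, any other non-trivial
    cut at least three; all values on the nine vertices are checked. *)
Lemma pinner_ge (f : pet -> bool) (u := fun i => f (i, None)) :
  let mixed := (u None != u (Some false)) || (u None != u (Some true)) in
  2 * mixed <= pinner f /\ (2 < pinner f \/ mixed \/ forall w, f w = u None).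
Proof.
rewrite {}/u /=.
have fE (w : pet) : f w = match w with
    | (None, None) => f (None, None)
    | (None, Some false) => f (None, Some false)
    | (None, Some true) => f (None, Some true)
    | (Some false, None) => f (Some false, None)
    | (Some false, Some false) => f (Some false, Some false)
    | (Some false, Some true) => f (Some false, Some true)
    | (Some true, None) => f (Some true, None)
    | (Some true, Some false) => f (Some true, Some false)
    | (Some true, Some true) => f (Some true, Some true)
    end by move: w => [[[]|] [[]|]].
suff [le [lt|[mx|al]]] : 2 * ((f (None, None) != f (Some false, None))
       || (f (None, None) != f (Some true, None))) <= pinner f /\
    (2 < pinner f \/
     (f (None, None) != f (Some false, None)) || (f (None, None) != f (Some true, None)) \/
     [&& f (None, Some false) == f (None, None), f (None, Some true) == f (None, None),
         f (Some false, Some false) == f (None, None), f (Some false, Some true) == f (None, None),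
         f (Some true, Some false) == f (None, None), f (Some true, Some true) == f (None, None),
         f (Some false, None) == f (None, None) & f (Some true, None) == f (None, None)]).
- by split; [|left].
- by split; [|right; left].
- split=> //; right; right => w; rewrite fE.
  by case/and5P: al => /eqP e1 /eqP e2 /eqP e3 /eqP e4 /and4P[/eqP e5 /eqP e6 /eqP e7 /eqP e8];
    move: w => [[[]|] [[]|]].
rewrite /pinner !sum_tri /pleg /pstep /=; clear fE.
move: (f (None, None)) (f (Some false, None)) (f (Some true, None))
  (f (None, Some false)) (f (Some false, Some false)) (f (Some true, Some false))
  (f (None, Some true)) (f (Some false, Some true)) (f (Some true, Some true)).
by do 9!case; split=> //; auto.
Qed.

(** * Cuts of four joined Petersen blocks *)

Section PetersenCut.

Variable N : {set pnode}.

Definition plegs b : nat :=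
  \sum_i (((b, (i, None)) \in N) && ((opposite b i, (i, None)) \notin N)).

Lemma petersen_cutE :
  #|[set z : pnode * tri | (z.1 \in N) && ((psigma z).1 \notin N)]| =
  \sum_b (pinner (fun w => (b, w) \in N) + plegs b).
Proof.
rewrite card_set_sum.
rewrite !sum_pair; apply: eq_bigr => b1 _; apply: eq_bigr => b2 _.
rewrite sum_pair /pinner /plegs -big_split /=; apply: eq_bigr => i _.
rewrite !sum_tri /psigma /pleg /pstep /=; lia.
Qed.

(** Unless one block has three cut edges, each block is mixed, with at least two, or constant. What
    remains depends only on the twelve leg vertices and is checked exhaustively. *)
Lemma petersen_cut : N != set0 -> N != setT ->
  3 <= #|[set z : pnode * tri | (z.1 \in N) && ((psigma z).1 \notin N)]|.
Proof.
move=> N0 NT; rewrite petersen_cutE.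
pose f b w := (b, w) \in N.
have [/existsP[b lt]|/existsPn nlt] := boolP [exists b, 2 < pinner (f b)].
  by rewrite (bigD1 b) //= -addnA; apply: leq_trans lt _; rewrite leq_addr.
pose mixed b := (f b (None, None) != f b (Some false, None)) ||
  (f b (None, None) != f b (Some true, None)).
have unif b : mixed b \/ forall w, f b w = f b (None, None).
  by have [_ [lt|]] := pinner_ge (f b); first by have := nlt b; rewrite lt.
have le : \sum_b (2 * mixed b + plegs b) <= \sum_b (pinner (f b) + plegs b).
  by apply: leq_sum => b _; rewrite leq_add2r; have [] := pinner_ge (f b).
suff [lt|eqf] : 2 < \sum_b (2 * mixed b + plegs b) \/
    forall b i, f b (i, None) = f (true, true) (None, None).
- exact: leq_trans lt le.
- have fE b w : f b w = f (true, true) (None, None).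
    by have [|->] := unif b; rewrite /mixed !eqf // eqxx.
  case: (boolP (f (true, true) (None, None))) => [c|/negbTE c].
    by case/eqP: NT; apply/setP => -[b w]; rewrite inE -[LHS]/(f b w) fE c.
  by case/eqP: N0; apply/setP => -[b w]; rewrite inE -[LHS]/(f b w) fE c.
clear unif le nlt N0 NT.
suff [lt|al] : 2 < \sum_b (2 * mixed b + plegs b) \/
    all (fun bi => f bi.1 (bi.2, None) == f (true, true) (None, None))
      [seq (b, i) | b <- [:: (true, true); (true, false); (false, true); (false, false)],
                    i <- [:: None; Some true; Some false]].
- by left.
- right=> b i; move/allP: al => /(_ (b, i)) al; apply/eqP/al.
  by move: b i {al} => [[] []] [[]|].
rewrite sum_pair !big_bool /mixed /plegs !sum_tri /= -!/(f _ _) /=.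
move: (f (true, true) (None, None)) (f (true, false) (None, None))
  (f (false, true) (None, None)) (f (false, false) (None, None))
  (f (true, true) (Some true, None)) (f (true, false) (Some true, None))
  (f (false, true) (Some true, None)) (f (false, false) (Some true, None))
  (f (true, true) (Some false, None)) (f (true, false) (Some false, None))
  (f (false, true) (Some false, None)) (f (false, false) (Some false, None)).
by do 12!case; auto.
Qed.

End PetersenCut.

(** A leg vertex with half of the 6-cycle, between its two neighbours there; the default of [odflt]
    never occurs. *)
Definition pentagon (i : tri) (c : bool) : seq pet :=
  let w1 := pnext i c in
  let w2 := pnext w1.1 (odflt c w1.2) in
  [:: (i, None); (i, Some c); w1; w2; pnext w2.1 (odflt c w2.2)].

(* If no leg is used, the whole block is closed; otherwise a 2-factor of the Petersen graph
   consists of two pentagons, one of which avoids the deleted vertex. *)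
Lemma petersen_two_factor (x : pet -> tri -> bool) :
    (forall w q, ~~ pleg w q -> x (pstep w q).1 (pstep w q).2 = x w q) ->
    (forall w, \sum_q x w q = 2) ->
  exists s : seq pet, s != [::] /\
    forall w q, w \in s -> x w q -> ~~ pleg w q && ((pstep w q).1 \in s).
Proof.
move=> xs deg.
pose closed (s : seq pet) := all (fun w => all (fun q => x w q ==>
  ~~ pleg w q && ((pstep w q).1 \in s)) [:: None; Some false; Some true]) s.
suff [s [s0 cl]] : exists s : seq pet, s != [::] /\ closed s.
  exists s; split=> // w q ws; have /allP/(_ w ws)/allP/(_ q) := cl.
  by move: q => [[]|] /(_ isT) /implyP.
(* Identifying the two halves of each edge leaves fifteen values: three legs, six spokes and six
   edges of the 6-cycle. *)
have xu i c : x (i, Some c) None = x (i, None) (Some c).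
  by rewrite -[RHS]xs.
have xc i c : x (i, Some c) (Some false) = x (pprev i c) (Some true).
  by rewrite -[LHS]xs.
pose full : seq pet := [seq (i, k) | i <- [:: None; Some false; Some true],
  k <- [:: None; Some false; Some true]].
have : has closed [:: full; pentagon None false; pentagon None true;
    pentagon (Some false) false; pentagon (Some false) true;
    pentagon (Some true) false; pentagon (Some true) true].
  have := deg (None, None); have := deg (Some false, None); have := deg (Some true, None).
  have := deg (None, Some false); have := deg (Some false, Some false).
  have := deg (Some true, Some false).
  have := deg (None, Some true); have := deg (Some false, Some true).
  have := deg (Some true, Some true).
  rewrite !sum_tri /closed /pentagon /full /= ?xu ?xc /=.
  clear.
  move: (x (None, None) None) (x (None, None) (Some false)) (x (None, None) (Some true)).
  move: (x (Some false, None) None) (x (Some false, None) (Some false))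
    (x (Some false, None) (Some true)).
  move: (x (Some true, None) None) (x (Some true, None) (Some false))
    (x (Some true, None) (Some true)).
  move: (x (None, Some false) (Some true)) (x (None, Some true) (Some true))
    (x (Some false, Some false) (Some true)) (x (Some false, Some true) (Some true))
    (x (Some true, Some false) (Some true)) (x (Some true, Some true) (Some true)).
  move=> x0 x1 x2 x3 x4 x5 x6 x7 x8 x9 x10 x11 x12 x13 x14.
  case: x3; case: x5; case: x8 => //; case: x1; case: x11 => //; case: x4; case: x14 => //;
  case: x2; case: x7 => //; case: x0; case: x10 => //; case: x13 => //;
  by case: x6 => //; case: x9 => //; case: x12.
rewrite /= orbF; repeat (case/orP; first by move=> cl; eexists; split; last exact: cl).
by move=> cl; eexists; split; last exact: cl.
Qed.

End PetersenBlocks.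

(** At most two vertices are defects, so one of the four copies is free of them; its closed vertex
    set contradicts the connectedness of the used edges. *)
Lemma single_connector_counterexample :
  exists F : nat -> tgraph,
    (forall i j : nat, i <> j -> ~ tgraph_iso (F i) (F j)) /\
    (forall i : nat,
       edge_connected_in 3 (terms (F i)) /\ ~ has_disjoint_Tconnectors 1 (terms (F i))).
Proof.
exists (fun m => gtgraph ptau 0 m psigma_node); split.
  by move=> i j ij /gtgraph_iso_pad.
move=> m; split.
  apply: (gterms_edge_connected psigmaK); first exact: ptau_inj.
  by move=> N N0 NT; rewrite mul0n add0n; apply: petersen_cut.
move=> /(connectors_two_factor psigmaK ptau_neq) [x [xs bad /(_ erefl) conn]].
have [b bP] : exists b, forall w, \sum_q x ((b, w), q) = 2.
  have [/existsP[b /forallP bP]|nb] := boolP [exists b, forall w, \sum_q x ((b, w), q) == 2].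
    by exists b => w; apply/eqP.
  suff : 3 < #|[set v | \sum_i x (v, i) != 2]| by move: bad; lia.
  have <- : #|{: bool * bool}| = 4 by rewrite card_prod card_bool.
  rewrite -cardsT; apply: leq_trans (leq_imset_card fst _).
  apply: subset_leq_card; apply/subsetP => b _.
  have := existsPn nb b; rewrite negb_forall => /existsP[w wP].
  by apply/imsetP; exists (b, w); rewrite ?inE.
have [||s [s0 scl]] := @petersen_two_factor (fun w q => x ((b, w), q)).
- by move=> w q lwq; rewrite -[RHS]xs /= (negbTE lwq).
- exact: bP.
case: s s0 scl => [//|w0 s] _ scl.
pose S : {set pnode} := [set v | (v.1 == b) && (v.2 \in w0 :: s)].
have [|S0|ST] := conn S.
- move=> [[b' w] q] xz; rewrite !inE /= => /andP[/eqP bb' ws]; rewrite bb' in xz *.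
  have /andP[lwq cl] := scl w q ws xz.
  by rewrite (negbTE lwq) /= eqxx; move: cl; rewrite inE.
- by have := in_set0 (b, w0); rewrite -S0 !inE !eqxx.
- have nb : (~~ b.1, b.2) != b by case: (b) => -[] [].
  by have := in_setT (opposite b None, w0); rewrite -ST inE /= (negbTE nb).
Qed.

Theorem theorem1p2 (l : nat) :
  exists F : nat -> tgraph,
    (forall i j : nat, i <> j -> ~ tgraph_iso (F i) (F j)) /\
    (forall i : nat,
       edge_connected_in (3 * 2 ^ l) (terms (F i)) /\
       ~ has_disjoint_Tconnectors (2 ^ l) (terms (F i))).
Proof.
case: l => [|l]; first exact: single_connector_counterexample.
(* The construction is indexed by [d], one less than the number of connectors, which is positive
   here. *)
have -> : 2 ^ l.+1 = (2 ^ l.+1).-1.+1 by rewrite prednK // expn_gt0.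
apply: many_connectors_counterexample.
by rewrite expnS; have := expn_gt0 2 l; lia.
Qed.
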